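(* Let $n\ge 1$ be a natural number, and let $G_{n+1:1}\le\cdots\le G_{n+1:n+1}$ be the ordered spacings of $n$ independent random variables uniformly distributed on $[0,1]$ (as defined in the context). Then for all integers $k$ with $1\le k\le n+1$ and all $x\in[0,1]$ $$\mathsf{P}(G_{n+1:k}>x)=(-1)^{k+1}(n+1)\binom{n}{k-1}\sum_{r=0}^{k-1}\frac{(-1)^r}{n-r+1}\binom{k-1}{r}\big(1-(n-r+1)x\big)_+^n.$$
   Context: Let $U_1,\dots,U_n$ be independent random variables, each uniformly distributed on $[0,1]$, and let $U_{n:1}\le\cdots\le U_{n:n}$ be the corresponding order statistics. Put $U_{n:0}:=0$ and $U_{n:n+1}:=1$. The gaps (spacings) are $G_i:=U_{n:i}-U_{n:i-1}$ for integers $i$ with $1\le i\le n+1$. Let $G_{n+1:1}\le\cdots\le G_{n+1:n+1}$ denote the values $G_1,\dots,G_{n+1}$ arranged in nondecreasing order (their order statistics, counted with multiplicity). Notation: $u_+:=\max(0,u)$ for real $u$, and $u_+^n:=(u_+)^n$. *)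

(* Defs.v *)
From HB Require Import structures.
From mathcomp Require Import all_boot all_order all_algebra.
From mathcomp Require Import all_classical all_reals all_analysis.

Set Implicit Arguments.
Unset Strict Implicit.
Unset Printing Implicit Defensive.
Import Order.TTheory GRing.Theory Num.Theory.
Import numFieldNormedType.Exports.

Local Open Scope classical_set_scope.
Local Open Scope ring_scope.

Definition mutually_independent (d d' : measure_display) (T : measurableType d)
    (T' : measurableType d') (R : realType) (P : probability T R) (I : finType)
    (X : I -> {RV P >-> T'}) : Prop :=
  forall (J : {set I}) (B : I -> set T'), (forall i, measurable (B i)) ->
    P [set w | forall i, i \in J -> B i (X i w)] =
    (\prod_(i in J) P [set w | B i (X i w)])%E.

(* Equality is required on measurable sets only: the value of a measure on
   other sets carries no meaning. *)
Definition uniform01 (d : measure_display) (T : measurableType d)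
    (R : realType) (P : probability T R) (X : {RV P >-> R}) : Prop :=
  forall B : set R, measurable B ->
    distribution P X B = uniform_prob (@ltr01 R) B.

(* Indexed from 1: for 1 <= k <= m, the k-th smallest of the m values of v,
   counted with multiplicity. *)
Definition order_stat (R : realType) (m : nat) (v : 'I_m -> R) (k : nat) : R :=
  nth 0 (sort <=%R [seq v i | i <- enum 'I_m]) k.-1.

Definition order_stat01 (R : realType) (n : nat) (u : 'I_n -> R) (i : nat) : R :=
  if i == 0%N then 0 else if i == n.+1 then 1 else order_stat u i.

(* 'I_n.+1 starts at 0, so the index i stands for the gap G_{i+1}. *)
Definition spacing (R : realType) (n : nat) (u : 'I_n -> R) (i : 'I_n.+1) : R :=
  order_stat01 u i.+1 - order_stat01 u i.

Definition ordered_spacing (R : realType) (n : nat) (u : 'I_n -> R) (k : nat) : R :=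
  order_stat (spacing u) k.

(* Main.v *)
Require Import Defs.
From HB Require Import structures.
From mathcomp Require Import all_boot all_order all_algebra.
From mathcomp Require Import all_classical all_reals all_analysis.
From mathcomp Require Import measurable_realfun zify lra ring.

Set Implicit Arguments.
Unset Strict Implicit.
Unset Printing Implicit Defensive.
Import Order.TTheory GRing.Theory Num.Theory.
Import numFieldNormedType.Exports.

Local Open Scope classical_set_scope.
Local Open Scope ring_scope.

(** Write [G_l] for the spacings and [S] for a set of spacing indices. Everything
follows from one formula, valid for every [S] and every [x >= 0]:

  P (G_l > x for all l in S) = (1 - |S| x)_+^n          (probability_spacings_gt)

The event that the [k]-th smallest spacing exceeds [x] says that more than
[n + 1 - k] of the [n + 1] spacings exceed [x]. Jordan's form of
inclusion-exclusion (probability_card_gt) writes the probability that more than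
[q] events of a finite family occur as an alternating sum of the probabilities
that all events of a subfamily occur; by the formula these depend only on the
size [j] of the subfamily, and there are ['C(n + 1, j)] of them. Setting
[j = n + 1 - r] and rearranging binomials (bin_reindex) gives the theorem.

The formula says that demanding width [x] from each of [|S|] spacings
amounts to throwing [n] uniform points on an interval shortened by [|S| x]: cut
a piece of length [x] out of each spacing in [S], or insert one to go back. This
cutting is made into an exact counting argument on a grid, so that no multiple
integral and no change of variables is needed. Divide [0, 1] into [N]
equal intervals. By independence each of the [N ^ n] boxes with such intervals as
sides has probability [N ^ - n]. The lower corner of a box is a function
[b : {1..n} -> {0..N-1}], its spacings differ from those of any sample in the box
by at most [1 / N] (spacing_Lipschitz), so it suffices to count the [b] whose
spacings in [S] have width at least [e] grid steps, up to [O (1 / N)]: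
- lowering every [b i] by [e] for each spacing of [S] lying below it
  is injective, with values in [{0..N - e |S| - 1}], so that there are at most
  [(N - e |S|) ^ n] such [b] (card_wide_grids_le);
- raising in the same way is injective on injective functions, so there are at
  least [(N - e |S|) ^_ n] of them (card_wide_grids_ge).
With [e] close to [N x], dividing by [N ^ n] and letting [N] grow yields
[(1 - |S| x)_+^n] from both sides.

Beyond a few elementary facts, order statistics are handled through the
equivalence between [order_stat v l <= t] and [l <= #{i | v i <= t}]
(order_stat_le), which says nothing about sorting. *)

(** * Order statistics and counting functions *)

Definition rank (R : realType) (m : nat) (v : 'I_m -> R) (t : R) : nat :=
  #|[pred i | v i <= t]|.

Lemma size_sort_values (R : realType) (m : nat) (v : 'I_m -> R) :
  size (sort <=%R [seq v i | i <- enum 'I_m]) = m.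
Proof. by rewrite size_sort size_map size_enum_ord. Qed.

Lemma count_sort_values (R : realType) (m : nat) (v : 'I_m -> R) (t : R) :
  count (fun y => y <= t) (sort <=%R [seq v i | i <- enum 'I_m]) = rank v t.
Proof.
rewrite (permP (permEl (perm_sort _ _))) count_map /rank cardE.
by rewrite -size_filter enumT.
Qed.

(** The Galois connection between order statistics and the counting function; it
replaces sorted sequences in most of what follows. *)
Lemma order_stat_le (R : realType) (m : nat) (v : 'I_m -> R) (l : nat) (t : R) :
  (0 < l <= m)%N -> (order_stat v l <= t) = (l <= rank v t)%N.
Proof.
move=> /andP[l0 lm]; rewrite -count_sort_values /order_stat.
have ss : sorted <=%R (sort <=%R [seq v i | i <- enum 'I_m]).
  exact/sort_sorted/le_total.
apply/idP/idP => [|lc]; last by apply: nth_count_le => //; rewrite prednK.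
rewrite leNgt; apply: contraNleq => cl.
by apply: nth_count_gt => //; rewrite size_sort_values prednK // lm andbT -ltnS prednK.
Qed.

Lemma rank_order_stat_ge (R : realType) (m : nat) (v : 'I_m -> R) (l : nat) :
  (0 < l <= m)%N -> (l <= rank v (order_stat v l))%N.
Proof. by move=> lm; rewrite -order_stat_le. Qed.

Lemma order_stat_mem (R : realType) (m : nat) (v : 'I_m -> R) (l : nat) :
  (0 < l <= m)%N -> exists i, order_stat v l = v i.
Proof.
move=> /andP[l0 lm].
have : order_stat v l \in sort <=%R [seq v i | i <- enum 'I_m].
  by rewrite mem_nth // size_sort_values prednK.
by rewrite mem_sort => /mapP[i _ ->]; exists i.
Qed.

Lemma leq_rank (R : realType) (m : nat) (v : 'I_m -> R) (s t : R) :
  s <= t -> (rank v s <= rank v t)%N.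
Proof.
by move=> st; apply: subset_leq_card; apply/fintype.subsetP => i; rewrite !inE => /le_trans; exact.
Qed.

Lemma rank_le (R : realType) (m : nat) (v : 'I_m -> R) (t : R) :
  (rank v t <= m)%N.
Proof. by rewrite -[X in (_ <= X)%N]card_ord max_card. Qed.

Lemma rank_gt0 (R : realType) (m : nat) (v : 'I_m -> R) (i : 'I_m) :
  (0 < rank v (v i))%N.
Proof. by apply/card_gt0P; exists i; rewrite inE. Qed.

(** Ties are harmless: [rank] counts all copies of a value, and the last of them
sits at that position. *)
Lemma order_stat_rank (R : realType) (m : nat) (v : 'I_m -> R) (i : 'I_m) :
  order_stat v (rank v (v i)) = v i.
Proof.
have lm : (0 < rank v (v i) <= m)%N by rewrite rank_gt0 rank_le.
apply/eqP; rewrite eq_le order_stat_le // leqnn /= leNgt; apply/negP => lt.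
have := rank_order_stat_ge v lm; apply/negP; rewrite -ltnNge /rank.
rewrite [X in (_ < X)%N](cardD1 i) inE lexx ltnS.
apply/subset_leq_card/fintype.subsetP => j; rewrite !inE => jlt.
have ji := le_lt_trans jlt lt; rewrite (ltW ji) andbT.
by apply: contraTneq ji => ->; rewrite ltxx.
Qed.

Lemma order_stat_Lipschitz (R : realType) (m : nat) (u v : 'I_m -> R) (c : R) (l : nat) :
  (0 < l <= m)%N -> (forall i, u i <= v i + c) ->
  order_stat u l <= order_stat v l + c.
Proof.
move=> lm uv; rewrite order_stat_le //.
apply: leq_trans (rank_order_stat_ge v lm) _.
apply: subset_leq_card; apply/fintype.subsetP => i; rewrite !inE => vi.
by apply: le_trans (uv i) _; rewrite lerD2r.
Qed.

(** A nondecreasing map sends the sorted sequence to a sorted sequence, even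
when it creates ties. *)
Lemma order_stat_homo (R : realType) (m : nat) (u : 'I_m -> R) (F : R -> R) (l : nat) :
  (0 < l <= m)%N -> {homo F : s t / s <= t} ->
  order_stat (F \o u) l = F (order_stat u l).
Proof.
move=> /andP[l0 lm] hF; rewrite /order_stat.
rewrite -(nth_map 0 0) ?size_sort_values ?prednK //; congr (nth 0 _ _).
apply: (sorted_eq le_trans le_anti); first exact/sort_sorted/le_total.
  exact/(homo_sorted hF)/sort_sorted/le_total.
by rewrite perm_sort (map_comp F) perm_sym perm_map // perm_sort.
Qed.

Lemma rank_order_stat_inj (R : realType) (m : nat) (v : 'I_m -> R) (l : nat) :
  injective v -> (0 < l <= m)%N -> rank v (order_stat v l) = l.
Proof.
move=> vi /andP[l0 lm]; rewrite -count_sort_values /order_stat.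
rewrite count_le_nth ?prednK ?size_sort_values //.
rewrite lt_sorted_uniq_le sort_uniq map_inj_uniq // enum_uniq /=.
exact/sort_sorted/le_total.
Qed.

(** The [l]-th smallest of [m] values exceeds [t] when at most [l - 1] of them
do not; this turns the event of the theorem into a count of large spacings. *)
Lemma lt_order_statE (R : realType) (m : nat) (v : 'I_m -> R) (l : nat) (t : R) :
  (0 < l <= m)%N ->
  (t < order_stat v l) = (m.+1 - l <= #|[set i | (t < v i)%R]%SET|)%N.
Proof.
move=> lm; rewrite ltNge order_stat_le //.
have := cardC [pred i | v i <= t]; rewrite card_ord -/(rank v t).
rewrite (_ : #|_| = #|[set i | (t < v i)%R]%SET|); first by lia.
by apply: eq_card => i; rewrite !inE -ltNge.
Qed.

Section spacings_of_points.
Variables (R : realType) (n : nat) (u : 'I_n -> R).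
Hypothesis u01 : forall i, 0 <= u i <= 1.

Lemma order_stat01_ge0 (l : nat) : (l <= n.+1)%N -> 0 <= order_stat01 u l.
Proof.
move=> ln; rewrite /order_stat01; case: eqP => // /eqP l0; case: eqP => // l1.
have [|i ->] := @order_stat_mem R n u l; first by lia.
by case/andP: (u01 i).
Qed.

Lemma order_stat01_homo (l : nat) : (l <= n)%N ->
  order_stat01 u l <= order_stat01 u l.+1.
Proof.
move=> ln; case: (eqVneq l 0%N) => [->|l0]; first exact: order_stat01_ge0.
have lm : (0 < l <= n)%N by rewrite lt0n l0.
rewrite /order_stat01 (negbTE l0) eqSS /= ifF; last by lia.
case: eqP => [_|/eqP ln'].
  have [i ->] := @order_stat_mem R n u l lm.
  by case/andP: (u01 i).
rewrite order_stat_le //; apply: leq_trans (rank_order_stat_ge _ _) => //.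
by lia.
Qed.

Lemma order_stat01_rank (i : 'I_n) : order_stat01 u (rank u (u i)) = u i.
Proof.
rewrite /order_stat01 ifF; last by apply/negbTE; rewrite -lt0n rank_gt0.
by rewrite ifF ?order_stat_rank //; have := rank_le u (u i); lia.
Qed.

End spacings_of_points.

(** * Counting grid points with wide spacings *)

(** Spacing indices start at 0, so this counts the spacings of [S] that lie
below the [r]-th order statistic. *)
Definition count_below (n : nat) (S : {set 'I_n.+1}) (r : nat) : nat :=
  #|[set l in S | (l < r)%N]%SET|.

Lemma count_below0 (n : nat) (S : {set 'I_n.+1}) : count_below S 0 = 0%N.
Proof. by apply: eq_card0 => l; rewrite !inE andbF. Qed.

Lemma count_belowS (n : nat) (S : {set 'I_n.+1}) (l : 'I_n.+1) :
  count_below S l.+1 = ((l \in S) + count_below S l)%N.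
Proof.
rewrite /count_below (cardD1 l) !inE ltnSn andbT; congr (_ + _)%N.
apply: eq_card => j; rewrite !inE ltnS ltn_neqAle.
by rewrite andbCA -val_eqE.
Qed.

Lemma count_below_max (n : nat) (S : {set 'I_n.+1}) : count_below S n.+1 = #|S|.
Proof. by apply: eq_card => l; rewrite !inE ltn_ord andbT. Qed.

Lemma leq_count_below (n : nat) (S : {set 'I_n.+1}) (r s : nat) :
  (r <= s)%N -> (count_below S r <= count_below S s)%N.
Proof.
move=> rs; apply/subset_leq_card/fintype.subsetP => l; rewrite !inE.
by case/andP=> -> /leq_trans; apply.
Qed.

(** The distance between two order statistics is the sum of the spacings between
them, of which those in [S] contribute at least [c] and the others at least 0.
*)
Lemma sum_spacings_ge (R : realType) (n : nat) (u : 'I_n -> R) (c : R)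
    (S : {set 'I_n.+1}) (r s : nat) :
  (forall i, 0 <= u i <= 1) -> (forall l, l \in S -> c <= spacing u l) ->
  (r <= s <= n.+1)%N ->
  c * ((count_below S s)%:R - (count_below S r)%:R) <=
  order_stat01 u s - order_stat01 u r.
Proof.
move=> u01 cS /andP[rs sn]; rewrite -(subnKC rs).
have : (r + (s - r) <= n.+1)%N by rewrite subnKC.
elim: (s - r)%N => [|k IH]; first by rewrite addn0 !subrr mulr0.
rewrite addnS => kn; have {}IH := IH (ltnW kn).
have -> := @count_belowS n S (Ordinal kn); rewrite natrD /=.
have gap : c * (Ordinal kn \in S)%:R <= order_stat01 u (r + k).+1 - order_stat01 u (r + k).
  case: (boolP (_ \in S)) => [/cS|_]; first by rewrite mulr1.
  by rewrite mulr0 subr_ge0 order_stat01_homo.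
lra.
Qed.

(** The lower corner, in the unit cube, of the box indexed by [a]. *)
Definition grid (R : realType) (n N : nat) (a : {ffun 'I_n -> 'I_N}) (i : 'I_n) : R :=
  (a i)%:R / N%:R.

(** This is [rank] of [grid a] at its own value, kept on [nat] so that the
cutting and inserting maps can be compared without reference to the scale. *)
Definition grid_rank (n N : nat) (a : {ffun 'I_n -> 'I_N}) (i : 'I_n) : nat :=
  #|[pred j | (a j <= a i)%N]|.

Lemma card_ord_lt (N M : nat) : (M <= N)%N -> #|[pred k : 'I_N | (k < M)%N]| = M.
Proof.
move=> MN; rewrite -sum1_card -(big_ord_widen N (fun=> 1%N) MN).
by rewrite sum1_card card_ord.
Qed.

Section grids.
Variables (R : realType) (n N : nat).
Implicit Types a b : {ffun 'I_n -> 'I_N.+1}.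

Lemma grid01 a i : 0 <= grid R a i <= 1.
Proof.
by rewrite divr_ge0 //= ler_pdivrMr // mul1r ler_nat ltnW.
Qed.

Lemma le_grid a i j : (grid R a i <= grid R a j) = (a i <= a j)%N.
Proof. by rewrite ler_pM2r ?invr_gt0 // ler_nat. Qed.

Lemma rank_grid a i : rank (grid R a) (grid R a i) = grid_rank a i.
Proof. by apply: eq_card => j; rewrite !inE le_grid. Qed.

Lemma grid_rank_le a i : (grid_rank a i <= n)%N.
Proof. by rewrite -[X in (_ <= X)%N](card_ord n) max_card. Qed.

Lemma leq_grid_rank a i j : (a i <= a j)%N -> (grid_rank a i <= grid_rank a j)%N.
Proof.
move=> ij; apply/subset_leq_card/fintype.subsetP => k; rewrite !inE.
by move/leq_trans; apply.
Qed.

(* [e] grid steps are to be removed from, or inserted into, each spacing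
   of [S]. *)
Variables (S : {set 'I_n.+1}) (e : nat).

(** The displacement of the [i]-th point: [e] steps for each spacing of [S]
below it. It depends on [a] through ranks only, which is why the displacement
can be undone once ranks are known to be preserved. *)
Definition shift a i : nat := e * count_below S (grid_rank a i).

Lemma leq_shift a i j : (a i <= a j)%N -> (shift a i <= shift a j)%N.
Proof. by move=> ij; rewrite leq_mul2l leq_count_below ?orbT // leq_grid_rank. Qed.

Definition squeeze a : {ffun 'I_n -> 'I_N.+1} := [ffun i => inord (a i - shift a i)].

Definition stretch a : {ffun 'I_n -> 'I_N.+1} := [ffun i => inord (a i + shift a i)].

Section squeeze.
Variables (c : R) (b : {ffun 'I_n -> 'I_N.+1}).
Hypotheses (ec : e%:R < c * N.+1%:R)
  (wide : forall l, l \in S -> c <= spacing (grid R b) l).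

Let N_gt0 : 0 < N.+1%:R :> R. Proof. by rewrite ltr0n. Qed.

Let gridE i : N.+1%:R * grid R b i = (b i)%:R.
Proof. by rewrite mulrC divfK // pnatr_eq0. Qed.

(* The spacings in [S] are longer than [e] steps, hence the strict version when
   the range contains one of them; strictness is what keeps distinct points
   distinct after the cut. *)
Let gap_ge r s : (r <= s <= n.+1)%N ->
  e%:R * ((count_below S s)%:R - (count_below S r)%:R) <=
  N.+1%:R * (order_stat01 (grid R b) s - order_stat01 (grid R b) r).
Proof.
move=> rs; apply: le_trans (ler_wpM2l (ltW N_gt0)
  (sum_spacings_ge (grid01 b) wide rs)).
rewrite mulrA; apply: ler_wpM2r; last by rewrite mulrC ltW.
by rewrite subr_ge0 ler_nat leq_count_below //; case/andP: rs.
Qed.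

Let gap_gt r s : (r <= s <= n.+1)%N -> (count_below S r < count_below S s)%N ->
  e%:R * ((count_below S s)%:R - (count_below S r)%:R) <
  N.+1%:R * (order_stat01 (grid R b) s - order_stat01 (grid R b) r).
Proof.
move=> rs lt; apply: lt_le_trans (ler_wpM2l (ltW N_gt0)
  (sum_spacings_ge (grid01 b) wide rs)).
by rewrite mulrA ltr_pM2r 1?mulrC // subr_gt0 ltr_nat.
Qed.

Let shift_le i : (shift b i <= b i)%N.
Proof.
have := @gap_ge 0 (grid_rank b i); rewrite leq0n (leq_trans (grid_rank_le b i)) //.
move=> /(_ isT).
by rewrite count_below0 subr0 -rank_grid order_stat01_rank subr0 gridE -natrM ler_nat rank_grid.
Qed.

Let squeeze_lt i j : (b j < b i)%N -> (b j - shift b j < b i - shift b i)%N.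
Proof.
move=> ji; have rk := leq_grid_rank (ltnW ji).
have rs : (grid_rank b j <= grid_rank b i <= n.+1)%N.
  by rewrite rk (leq_trans (grid_rank_le b i)).
have : (b j + shift b i < b i + shift b j)%N.
  case: (ltngtP (count_below S (grid_rank b j)) (count_below S (grid_rank b i))).
  - move=> lt; have := gap_gt rs lt.
    rewrite -!rank_grid !order_stat01_rank !mulrBr !gridE -!natrM !rank_grid.
    by rewrite -(ltr_nat R) !natrD; rewrite /shift; lra.
  - by rewrite ltnNge leq_count_below.
  - by move=> eq; rewrite /shift eq ltn_add2r.
by have := shift_le i; have := shift_le j; lia.
Qed.

Let squeeze_bound i : (b i - shift b i < N.+1 - e * #|S|)%N.
Proof.
have rs : (grid_rank b i <= n.+1 <= n.+1)%N.
  by rewrite leqnn (leq_trans (grid_rank_le b i)).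
have : (b i + e * #|S| < N.+1 + shift b i)%N.
  have os1 : order_stat01 (grid R b) n.+1 = 1 by rewrite /order_stat01 eqxx.
  rewrite -(count_below_max S).
  case: (ltngtP (count_below S (grid_rank b i)) (count_below S n.+1)).
  - move=> lt; have := gap_gt rs lt.
    rewrite os1 -rank_grid order_stat01_rank !mulrBr gridE -!natrM rank_grid.
    by rewrite -(ltr_nat R) !natrD; rewrite /shift; lra.
  - by rewrite ltnNge leq_count_below //; case/andP: rs.
  - by move=> eq; rewrite /shift eq ltn_add2r.
by have := shift_le i; lia.
Qed.

Lemma squeezeE i : squeeze b i = (b i - shift b i)%N :> nat.
Proof. by rewrite ffunE inordK // ltnS (leq_trans (leq_subr _ _)) // -ltnS. Qed.

Lemma squeeze_ltn i : (squeeze b i < N.+1 - e * #|S|)%N.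
Proof. by rewrite squeezeE. Qed.

(** Cutting is strictly increasing on the values taken by [b] and keeps ties,
hence ranks survive. *)
Lemma grid_rank_squeeze i : grid_rank (squeeze b) i = grid_rank b i.
Proof.
apply: eq_card => j; rewrite !inE !squeezeE.
case: (leqP (b j) (b i)) => [|/squeeze_lt]; last by rewrite ltnNge => /negbTE.
rewrite leq_eqVlt => /orP[/eqP eq|/squeeze_lt/ltnW //].
suff -> : shift b j = shift b i by rewrite eq leqnn.
by apply/eqP; rewrite eqn_leq !leq_shift // eq.
Qed.

(** Injectivity of the cut: the displacement is computed from the ranks of the
image. *)
Lemma squeezeK i : (squeeze b i + e * count_below S (grid_rank (squeeze b) i))%N = b i.
Proof. by rewrite grid_rank_squeeze squeezeE subnK. Qed.

End squeeze.

(** The cut maps wide configurations injectively to arbitrary ones on a grid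
with [e * #|S|] fewer points. *)
Lemma card_wide_grids_le (c : R) : e%:R < c * N.+1%:R ->
  (#|[set b : {ffun 'I_n -> 'I_N.+1} | [forall l in S, (c <= spacing (grid R b) l)%R]]%SET|
   <= (N.+1 - e * #|S|) ^ n)%N.
Proof.
move=> ec; set W := [set b | _]%SET.
have wideP b : b \in W -> forall l, l \in S -> c <= spacing (grid R b) l.
  by rewrite inE => /forall_inP.
have <- : #|squeeze @: W| = #|W|.
  apply: card_in_imset => b b' /wideP wb /wideP wb' eq.
  by apply/ffunP => i; apply/val_inj; rewrite /= -(squeezeK ec wb) -(squeezeK ec wb') eq.
have cardM : #|[pred k : 'I_N.+1 | (k < N.+1 - e * #|S|)%N]| = (N.+1 - e * #|S|)%N.
  by rewrite card_ord_lt // leq_subr.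
rewrite -[X in (_ <= _ ^ X)%N](card_ord n) -cardM -card_ffun_on.
apply/subset_leq_card/fintype.subsetP => _ /imsetP[b /wideP wb ->].
by apply/ffun_onP => i; rewrite inE (squeeze_ltn ec wb).
Qed.

Section stretch.
Variables (M : nat) (a : {ffun 'I_n -> 'I_N.+1}).
Hypotheses (fits : (M + e * #|S| <= N.+1)%N) (aM : forall i, (a i < M)%N)
  (ainj : injective a).

Lemma stretchE i : stretch a i = (a i + shift a i)%N :> nat.
Proof.
rewrite ffunE inordK //; apply: leq_trans fits; rewrite -addSn leq_add //.
by rewrite leq_mul2l -(count_below_max S) leq_count_below ?orbT // leqW ?grid_rank_le.
Qed.

Lemma grid_rank_stretch i : grid_rank (stretch a) i = grid_rank a i.
Proof.
apply: eq_card => j; rewrite !inE !stretchE.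
case: (leqP (a j) (a i)) => ij; first by rewrite leq_add // leq_shift.
by apply/negbTE; rewrite -ltnNge -addSn leq_add // leq_shift // ltnW.
Qed.

Lemma stretchK i : (stretch a i - e * count_below S (grid_rank (stretch a) i))%N = a i.
Proof. by rewrite grid_rank_stretch stretchE addnK. Qed.

Let gridinj : injective (grid R a).
Proof.
move=> i j ij; apply/ainj/val_inj/eqP.
by rewrite eqn_leq -!le_grid ij lexx.
Qed.

(** Injectivity of [a] matters here: the displacement at the [l]-th order
statistic is computed at its rank, which exceeds [l] inside a tie, and inserting
width into an empty spacing between tied points would be impossible. *)
Lemma order_stat_stretch l : (0 < l <= n)%N ->
  order_stat (grid R (stretch a)) l =
  order_stat (grid R a) l + (e * count_below S l)%:R / N.+1%:R.
Proof.
move=> ln; pose F t := t + (e * count_below S (rank (grid R a) t))%:R / N.+1%:R : R.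
have -> : grid R (stretch a) = F \o grid R a.
  by apply/funext => i; rewrite /F /= rank_grid /grid stretchE natrD mulrDl.
rewrite order_stat_homo // /F ?rank_order_stat_inj // => s t st.
rewrite lerD // ler_pM2r ?invr_gt0 ?ltr0n // ler_nat leq_mul2l.
by rewrite leq_count_below ?orbT // leq_rank.
Qed.

Lemma stretch_wide l : (0 < n)%N -> l \in S ->
  e%:R / N.+1%:R <= spacing (grid R (stretch a)) l.
Proof.
move=> n0 lS; rewrite /spacing.
have st k : (k <= n)%N -> order_stat01 (grid R (stretch a)) k =
    order_stat01 (grid R a) k + (e * count_below S k)%:R / N.+1%:R.
  rewrite /order_stat01; case: (eqVneq k 0%N) => [-> _|k0 kn].
    by rewrite count_below0 muln0 mul0r addr0.
  by rewrite ltn_eqF ?ltnS // order_stat_stretch // lt0n k0.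
rewrite (st l (leq_ord l)).
have cS : count_below S l.+1 = (1 + count_below S l)%N by rewrite count_belowS lS.
(* The last spacing ends at the constant 1 and not at a point of the sample, so its
   width comes from the room left above [M] rather than from a displacement. *)
have [ln|ln] := ltnP l n.
  rewrite (st l.+1 ln) cS mulnDr natrD mulrDl muln1.
  rewrite addrA opprD addrACA subrr addr0 addrAC lerDr subr_ge0.
  apply: (order_stat01_homo (grid01 a)); exact: ltnW.
have {}ln : l = n :> nat by apply/eqP; rewrite eqn_leq leq_ord.
move: cS; rewrite ln count_below_max => cS.
have -> : order_stat01 (grid R (stretch a)) n.+1 = 1 by rewrite /order_stat01 eqxx.
have -> : order_stat01 (grid R a) n = order_stat (grid R a) n.
  by rewrite /order_stat01 ifF ?ifF //; lia.
have [|i ->] := @order_stat_mem R n (grid R a) n; first by rewrite n0 leqnn.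
rewrite lerBrDr -!mulrDl -!natrD ler_pdivrMr ?ltr0n // mul1r ler_nat.
by move: (aM i) fits; rewrite cS mulnDr muln1; lia.
Qed.

End stretch.

(** Inserting [e] steps in every spacing of [S] is the reverse construction;
counting injective functions only gives a falling factorial, asymptotic to the
power in the upper bound. *)
Lemma card_wide_grids_ge (M : nat) : (0 < n)%N -> (M + e * #|S| <= N.+1)%N ->
  (M ^_ n <= #|[set b : {ffun 'I_n -> 'I_N.+1} |
     [forall l in S, (e%:R / N.+1%:R <= spacing (grid R b) l)%R]]%SET|)%N.
Proof.
move=> n0 fits; have MN : (M <= N.+1)%N by apply: leq_trans fits; exact: leq_addr.
rewrite -[X in (_ ^_ X <= _)%N](card_ord n) -{1}(card_ord_lt MN) -card_inj_ffuns_on.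
set A := [set a | _]%SET.
have AP a : a \in A -> (forall i, a i < M)%N /\ injective a.
  by rewrite inE => /andP[/ffun_onP aM /injectiveP].
have <- : #|stretch @: A| = #|A|.
  apply: card_in_imset => a a' /AP[aM ai] /AP[aM' ai'] eq.
  apply/ffunP => i; apply/val_inj.
  by rewrite -[LHS](stretchK fits aM) -[RHS](stretchK fits aM') eq.
apply/subset_leq_card/fintype.subsetP => _ /imsetP[a /AP[aM ai] ->].
by rewrite inE; apply/forall_inP => l lS; apply: (stretch_wide fits).
Qed.

End grids.

(** * Limits and measurability *)

(** The only limit in the proof: [(y + t)_+^n] is continuous in [t], and both
bounds tend to its value at [t = 0]. *)
Lemma squeeze_harmonic_pos_part (R : realType) (n : nat) (y K p : R) :
  (forall N, Num.max 0 (y - K / N.+1%:R) ^+ n <= p <= Num.max 0 (y + K / N.+1%:R) ^+ n) ->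
  p = Num.max 0 y ^+ n.
Proof.
move=> bnd.
have cvg c : (Num.max 0 (y + c / N.+1%:R) ^+ n : R^o) @[N --> \oo] --> (Num.max 0 y ^+ n : R^o).
  have lin : (y + c * harmonic N : R^o) @[N --> \oo] --> (y : R^o).
    rewrite -[X in _ --> X]addr0 -[X in _ + X](mulr0 c).
    apply: cvgD; first exact: cvg_cst.
    by apply: cvgM; [exact: cvg_cst | exact: cvg_harmonic].
  have cont : {for y, continuous (fun t : R^o => Num.max 0 t ^+ n : R^o)}.
    apply: (@continuous_comp _ _ _ (fun t : R^o => Num.max 0 t : R^o) (fun t : R^o => t ^+ n : R^o)).
      by apply: continuous_max; [exact: cst_continuous | exact: cvg_id].
    exact: exprn_continuous.
  exact: (@continuous_cvg _ _ _ _ _ (fun N => y + c * harmonic N : R^o)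
    (fun t : R^o => Num.max 0 t ^+ n : R^o) y cont lin).
apply/eqP; rewrite eq_le; apply/andP; split.
  by apply: (cvgr_to_ge (cvg K)); apply: nearW => N; case/andP: (bnd N).
apply: (cvgr_to_le (cvg (- K))); apply: nearW => N.
by rewrite mulNr; case/andP: (bnd N).
Qed.

Section random_vectors.
Context (R : realType) (d : measure_display) (T : measurableType d).

(** A random subset of a finite type with measurable membership events takes
finitely many values, each on a finite intersection of such events or their
complements. *)
Lemma measurable_finset_event (I : finType) (p : I -> T -> bool) (Q : {set I} -> bool) :
  (forall i, measurable [set w | p i w]) ->
  measurable [set w | Q [set i | p i w]%SET].
Proof.
move=> mp.
have -> : [set w | Q [set i | p i w]%SET] =
    \bigcup_(B in [set` [pred B | Q B]]) [set w | [set i | p i w]%SET = B].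
  apply/seteqP; split => [w Qw|w [B /= QB BE]]; last by rewrite BE.
  by exists [set i | p i w]%SET.
apply: fin_bigcup_measurable => [|B _]; first exact: finite_finset.
have -> : [set w | [set i | p i w]%SET = B] =
    \bigcap_(i in [set: I]) (if i \in B then [set w | p i w] else ~` [set w | p i w]).
  apply/seteqP; split => [w /= <- i _|w Bw].
    by rewrite inE; case: ifP => //= /negbT/negP.
  apply/setP => i; rewrite inE; have := Bw i Logic.I.
  by case: ifP => //= _ /negP/negbTE.
apply: fin_bigcap_measurable => [|i _]; first exact: finite_finset.
by case: ifP => _ //; exact: measurableC.
Qed.

Lemma measurable_order_stat (m : nat) (X : 'I_m -> T -> R) (l : nat) :
  (0 < l <= m)%N -> (forall i, measurable_fun setT (X i)) ->
  measurable_fun setT (fun w => order_stat (fun i => X i w) l).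
Proof.
move=> lm mX mT; apply: (measurability _ (RGenOInfty.measurableE R)) => //.
move=> /= _ [_ [t ->] <-]; rewrite setTI.
have -> : (fun w => order_stat (fun i => X i w) l) @^-1` `]t, +oo[ =
    [set w | (m.+1 - l <= #|[set i | t < X i w]%R%SET|)%N].
  by apply/seteqP; split => w /=; rewrite in_itv /= andbT lt_order_statE.
apply: (@measurable_finset_event _ (fun i w => t < X i w) (fun B => m.+1 - l <= #|B|)%N) => i.
have := mX i measurableT _ (measurable_itv `]t, +oo[).
by rewrite setTI; congr measurable; apply/seteqP; split => w /=; rewrite in_itv /= andbT.
Qed.

Lemma measurable_spacing (n : nat) (X : 'I_n -> T -> R) (l : 'I_n.+1) :
  (forall i, measurable_fun setT (X i)) ->
  measurable_fun setT (fun w => spacing (fun i => X i w) l).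
Proof.
move=> mX; have mos k : (k <= n.+1)%N ->
    measurable_fun setT (fun w => order_stat01 (fun i => X i w) k).
  move=> kn; rewrite /order_stat01; case: eqP => [_|/eqP k0]; first exact: measurable_cst.
  case: eqP => [_|/eqP kn1]; first exact: measurable_cst.
  by apply: measurable_order_stat => //; lia.
by apply: measurable_funB; apply: mos; rewrite // ltnW.
Qed.

Variables (P : probability T R).

Lemma probability_seq_bigcup (I : choiceType) (s : seq I) (C : I -> set T) :
  uniq s -> (forall a, measurable (C a)) ->
  (forall a b w, C a w -> C b w -> a = b) ->
  P (\bigcup_(a in [set` s]) C a) = (\sum_(a <- s) P (C a))%E.
Proof.
move=> us mC dC; rewrite measure_fin_bigcup //; first by rewrite -fsbig_seq.
by move=> a b _ _ [w [Ca Cb]]; exact: dC Ca Cb.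
Qed.

End random_vectors.

(** * Boxes of equal probability *)

Lemma order_stat01_Lipschitz (R : realType) (n : nat) (u v : 'I_n -> R) (c : R) (k : nat) :
  0 <= c -> (k <= n.+1)%N -> (forall i, u i <= v i + c) ->
  order_stat01 u k <= order_stat01 v k + c.
Proof.
move=> c0 kn uv; rewrite /order_stat01; case: eqP => [_|/eqP k0]; first by rewrite add0r.
case: eqP => [_|/eqP kn1]; first by rewrite lerDl.
by apply: order_stat_Lipschitz => //; lia.
Qed.

(** Both ends of a spacing move up by an amount between 0 and [c], so their
difference moves by at most [c] and not [2 c]. *)
Lemma spacing_Lipschitz (R : realType) (n : nat) (u v : 'I_n -> R) (c : R) (l : 'I_n.+1) :
  (0 < n)%N -> (forall i, v i <= u i <= v i + c) ->
  `|spacing u l - spacing v l| <= c.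
Proof.
move=> n0 uv.
have c0 : 0 <= c by have /andP[] := uv (Ordinal n0); lra.
have up k : (k <= n.+1)%N -> order_stat01 u k <= order_stat01 v k + c.
  by move=> kn; apply: order_stat01_Lipschitz => // i; case/andP: (uv i).
have lo k : (k <= n.+1)%N -> order_stat01 v k <= order_stat01 u k.
  move=> kn; rewrite -[leRHS]addr0; apply: order_stat01_Lipschitz => // i.
  by rewrite addr0; case/andP: (uv i).
have l1 : (l.+1 <= n.+1)%N by [].
rewrite /spacing ler_norml.
have := up _ l1; have := up _ (ltnW l1); have := lo _ l1; have := lo _ (ltnW l1).
by move=> *; apply/andP; split; lra.
Qed.

Lemma expn_leq_ffact (m n k : nat) : (k <= n)%N -> ((m - n) ^ k <= m ^_ k)%N.
Proof.
elim: k => [//|k IH] kn; rewrite expnSr ffactnSr leq_mul ?IH //; lia.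
Qed.

Lemma uniform_prob_itv (R : realType) (a b : R) : 0 <= a -> a <= b -> b <= 1 ->
  uniform_prob (@ltr01 R) `[a, b[%classic = (b - a)%:E.
Proof.
move=> a0 ab b1; rewrite /uniform_prob.
rewrite (eq_integral (cst 1%E)) => [|t].
  rewrite integral_cst // mul1e /= lebesgue_measure_itv /= lte_fin.
  by case: ltP => // ba; rewrite (@le_anti _ _ a b) ?ab // subrr.
rewrite inE /= in_itv /= => /andP[at_ tb]; rewrite /uniform_pdf.
by rewrite (le_trans a0 at_) (ltW (lt_le_trans tb b1)) subr0 invr1.
Qed.

Section uniform_sample.
Context (R : realType) (d : measure_display) (T : measurableType d).
Context (P : probability T R) (n : nat) (U : 'I_n -> {RV P >-> R}).
Hypotheses (U_indep : mutually_independent U) (U_unif : forall i, uniform01 (U i)).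

Definition cell (N : nat) (a : {ffun 'I_n -> 'I_N.+1}) : set T :=
  [set w | forall i, (a i)%:R / N.+1%:R <= U i w < (a i).+1%:R / N.+1%:R].

Lemma measurable_cell (N : nat) (a : {ffun 'I_n -> 'I_N.+1}) : measurable (cell a).
Proof.
have -> : cell a = \bigcap_(i in [set: 'I_n])
    (U i @^-1` `[(a i)%:R / N.+1%:R, (a i).+1%:R / N.+1%:R[).
  apply/seteqP; split => [w Cw i _|w Cw i]; first by rewrite /= in_itv /=; exact: Cw.
  by have := Cw i Logic.I; rewrite /= in_itv.
apply: fin_bigcap_measurable => [|i _]; first exact: finite_finset.
by rewrite -[X in measurable X]setTI; apply: measurable_funP => //; exact: measurable_itv.
Qed.

(** The only place where independence and uniformity enter. *)
Lemma probability_cell (N : nat) (a : {ffun 'I_n -> 'I_N.+1}) :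
  P (cell a) = (N.+1%:R ^- n)%:E.
Proof.
pose B i := `[(a i)%:R / N.+1%:R, (a i).+1%:R / N.+1%:R[%classic : set R.
have mB i : measurable (B i) by exact: measurable_itv.
have -> : cell a = [set w | forall i, i \in [set: 'I_n]%SET -> B i (U i w)].
  apply/seteqP; split => w Cw i; first by move=> _; rewrite /B /= in_itv /=; exact: Cw.
  by have := Cw i (finset.in_setT i); rewrite /B /= in_itv.
rewrite (U_indep _ mB).
rewrite (eq_bigr (fun=> (N.+1%:R^-1)%:E)) => [|i _].
  rewrite prodEFin big_const cardsT card_ord iter_mulr_1 exprVn //.
have := U_unif i (mB i); rewrite /distribution /pushforward /= => ->.
rewrite uniform_prob_itv ?divr_ge0 //.
- by rewrite -mulrBl -natrB // subSnn mul1r.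
- by rewrite ler_pM2r ?invr_gt0 // ler_nat.
- by rewrite ler_pdivrMr // mul1r ler_nat.
Qed.

Lemma cell_inj (N : nat) (a b : {ffun 'I_n -> 'I_N.+1}) (w : T) :
  cell a w -> cell b w -> a = b.
Proof.
move=> aw bw; apply/ffunP => i; apply/val_inj/eqP => /=.
have /andP[a1 a2] := aw i; have /andP[b1 b2] := bw i.
have := le_lt_trans a1 b2; have := le_lt_trans b1 a2.
rewrite !ltr_pM2r ?invr_gt0 // !ltr_nat !ltnS => ba ab.
by rewrite eqn_leq ab ba.
Qed.

(** Boxes are disjoint, so those contained in [E] give a lower bound by
counting. *)
Lemma card_cells_le (N : nat) (A : {set {ffun 'I_n -> 'I_N.+1}}) (E : set T) :
  measurable E -> (forall a, a \in A -> cell a `<=` E) ->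
  #|A|%:R / N.+1%:R ^+ n <= fine (P E).
Proof.
move=> mE AE; rewrite -lee_fin fineK ?fin_num_measure //.
have -> : (#|A|%:R / N.+1%:R ^+ n)%:E = P (\bigcup_(a in [set` enum A]) cell a).
  rewrite (probability_seq_bigcup P (enum_uniq _) (@measurable_cell N) (@cell_inj N)).
  rewrite big_enum /= (eq_bigr (fun=> (N.+1%:R ^- n)%:E)) => [|a _].
    by rewrite sumEFin sumr_const mulr_natl.
  exact: probability_cell.
apply: le_measure; rewrite ?inE //.
  by apply: fin_bigcup_measurable => [|a _]; [exact: finite_seq | exact: measurable_cell].
by move=> w [a /=]; rewrite mem_enum => /AE; exact.
Qed.

(** The previous bound for the complement of [E]. Going through the complement
avoids covering the sample space by boxes, which is possible only almost surely.
*)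
Lemma card_cells_ge (N : nat) (A : {set {ffun 'I_n -> 'I_N.+1}}) (E : set T) :
  measurable E -> (forall a w, cell a w -> E w -> a \in A) ->
  fine (P E) <= #|A|%:R / N.+1%:R ^+ n.
Proof.
move=> mE EA.
have : #|~: A|%:R / N.+1%:R ^+ n <= fine (P (~` E)).
  apply: card_cells_le; first exact: measurableC.
  by move=> a; rewrite inE => /negP aA w aw Ew; exact/aA/(EA a w).
rewrite probability_setC // fineB ?fin_num_measure //= cardsCs finset.setCK.
rewrite card_ffun !card_ord natrB; last first.
  by rewrite -[X in (_ <= X ^ _)%N](card_ord N.+1) -[X in (_ <= _ ^ X)%N](card_ord n) -card_ffun max_card.
rewrite natrX mulrBl divff ?expf_neq0 ?pnatr_eq0 //; lra.
Qed.

End uniform_sample.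

(** * The probability that given spacings are all large *)

Section spacing_survival.
Context (R : realType) (d : measure_display) (T : measurableType d).
Context (P : probability T R) (n : nat) (U : 'I_n -> {RV P >-> R}).
Hypotheses (U_indep : mutually_independent U) (U_unif : forall i, uniform01 (U i)).
Hypothesis n_gt0 : (0 < n)%N.
Variables (S : {set 'I_n.+1}) (x : R).
Hypothesis x_ge0 : 0 <= x.

Let E : set T := [set w | forall l, l \in S -> x < spacing (fun i => U i w) l].

Lemma measurable_lt_spacing (l : 'I_n.+1) :
  measurable [set w | x < spacing (fun i => U i w) l].
Proof.
have mU i : measurable_fun setT (U i) by exact: measurable_funP.
have := measurable_spacing l mU measurableT (measurable_itv `]x, +oo[).
by rewrite setTI; congr measurable; apply/seteqP; split => w /=; rewrite in_itv /= andbT.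
Qed.

Let measurable_E : measurable E.
Proof.
have -> : E = \bigcap_(l in [set` S]) [set w | x < spacing (fun i => U i w) l].
  by apply/seteqP; split => w Ew l; exact: Ew.
by apply: fin_bigcap_measurable => [|l _]; [exact: finite_finset | exact: measurable_lt_spacing].
Qed.

Let cell_spacing (N : nat) (a : {ffun 'I_n -> 'I_N.+1}) (w : T) (l : 'I_n.+1) :
  cell U a w -> `|spacing (fun i => U i w) l - spacing (grid R a) l| <= N.+1%:R^-1.
Proof.
move=> aw; apply: spacing_Lipschitz => // i; have /andP[ai ia] := aw i.
by rewrite ai /= /grid (le_trans (ltW ia)) // -natr1 mulrDl mul1r.
Qed.

Let card_S : (#|S| <= n.+1)%N.
Proof. by rewrite -[X in (_ <= X)%N](card_ord n.+1) max_card. Qed.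

Let truncE (N : nat) : (Num.truncn (N.+1%:R * x))%:R <= N.+1%:R * x < (Num.truncn (N.+1%:R * x)).+1%:R.
Proof. by apply: truncn_itv; rewrite mulr_ge0. Qed.

(* The error constant [3 * n.+1 + n] is crude: [e] is within 3 of [N x], which
   costs at most [3 * #|S|] grid steps, and passing from the falling factorial to a
   power costs [n] more. *)
Let survival_ge (N : nat) :
  Num.max 0 (1 - #|S|%:R * x - (3 * n.+1 + n)%:R / N.+1%:R) ^+ n <= fine (P E).
Proof.
have N0 : 0 < N.+1%:R :> R by rewrite ltr0n.
have [y0|y0] := leP (1 - #|S|%:R * x - (3 * n.+1 + n)%:R / N.+1%:R) 0.
  by rewrite expr0n gtn_eqF // fine_ge0.
(* Samples in the box may have spacings smaller by [1 / N] than its corner, hence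
   the requirement [N x + 1 < e]. *)
set e := (Num.truncn (N.+1%:R * x) + 2)%N.
have /andP[t1 t2] := truncE N.
have e1 : e%:R <= N.+1%:R * x + 2 by rewrite natrD lerD2r.
have e2 : N.+1%:R * x + 1 < e%:R by move: t2; rewrite /e natrD -natr1; lra.
have Se : #|S|%:R * e%:R <= #|S|%:R * (N.+1%:R * x + 2) :> R by rewrite ler_wpM2l.
have S3 : #|S|%:R * 2 <= (3 * n.+1)%:R :> R.
  by rewrite -natrM ler_nat; move: card_S; lia.
have ySe : N.+1%:R * (1 - #|S|%:R * x - (3 * n.+1 + n)%:R / N.+1%:R) <=
    N.+1%:R - e%:R * #|S|%:R - n%:R.
  have -> : N.+1%:R * (1 - #|S|%:R * x - (3 * n.+1 + n)%:R / N.+1%:R) =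
      N.+1%:R - #|S|%:R * (N.+1%:R * x) - (3 * n.+1 + n)%:R :> R by field.
  rewrite (natrD _ (3 * n.+1)); lra.
have pos : (e * #|S| + n < N.+1)%N.
  rewrite -(ltr_nat R) natrD natrM.
  by have := lt_le_trans (mulr_gt0 N0 y0) ySe; lra.
set M := (N.+1 - e * #|S|)%N.
have eS : (e * #|S| <= N.+1)%N := ltnW (leq_ltn_trans (leq_addr n _) pos).
have fits : (M + e * #|S| <= N.+1)%N by rewrite subnK.
apply: le_trans (card_cells_le U_indep U_unif (N := N) (A := [set b | [forall l in S,
  (e%:R / N.+1%:R <= spacing (grid R b) l)%R]]%SET) measurable_E _); last first.
  move=> a; rewrite inE => /forall_inP wide w aw l lS.
  have := wide l lS; have := cell_spacing l aw; rewrite ler_norml => /andP[+ _].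
  have : x + N.+1%:R^-1 < e%:R / N.+1%:R.
    by rewrite ltr_pdivlMr // mulrDl mulVf ?gt_eqF // mulrC.
  move=> xe us vl; rewrite -(ltrD2r N.+1%:R^-1) (lt_le_trans xe) // (le_trans vl) //.
  by rewrite -lerBlDl -lerN2 opprB.
rewrite -[leLHS](mulfK (expf_neq0 n (lt0r_neq0 N0))) ler_pM2r ?invr_gt0 ?exprn_gt0 //.
rewrite -exprMn.
apply: le_trans (_ : ((M - n) ^ n)%:R <= _); last first.
  by rewrite ler_nat (leq_trans (expn_leq_ffact _ (leqnn n))) // card_wide_grids_ge.
rewrite natrX lerXn2r ?nnegrE ?ler0n ?mulr_ge0 ?(ltW y0) ?(ltW N0) //.
rewrite mulrC (le_trans ySe) // natrB; last by rewrite leq_subRL // ltnW.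
by rewrite natrB // natrM.
Qed.

Let survival_le (N : nat) :
  fine (P E) <= Num.max 0 (1 - #|S|%:R * x + (3 * n.+1 + n)%:R / N.+1%:R) ^+ n.
Proof.
have N0 : 0 < N.+1%:R :> R by rewrite ltr0n.
have /andP[t1 t2] := truncE N.
(* The corner of a box meeting the event has spacings above [x - 1 / N], which must
   exceed [e / N]. *)
set e := (Num.truncn (N.+1%:R * x) - 2)%N.
have e2 : N.+1%:R * x <= e%:R + 3.
  apply: le_trans (ltW t2) _; rewrite -natrD ler_nat /e; lia.
have yE : N.+1%:R * (1 - #|S|%:R * x + (3 * n.+1 + n)%:R / N.+1%:R) =
    N.+1%:R - #|S|%:R * (N.+1%:R * x) + (3 * n.+1 + n)%:R by field.
have Se : #|S|%:R * (N.+1%:R * x) <= #|S|%:R * (e%:R + 3) :> R by rewrite ler_wpM2l.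
have S3 : #|S|%:R * 3 <= (3 * n.+1)%:R :> R.
  by rewrite -natrM ler_nat; move: card_S; lia.
have ySe : N.+1%:R - e%:R * #|S|%:R <=
    N.+1%:R * (1 - #|S|%:R * x + (3 * n.+1 + n)%:R / N.+1%:R).
  rewrite yE (natrD _ (3 * n.+1)); have := ler0n R n; lra.
(* For [N x < 3] the claimed upper bound is at least 1. *)
have [e0|e0] := posnP e.
  apply: le_trans (_ : 1 <= _).
    by rewrite -lee_fin fineK ?fin_num_measure // probability_le1.
  rewrite exprn_ege1 // le_max; apply/orP; right.
  by move: ySe; rewrite e0 mul0r subr0 -{1}[N.+1%:R]mulr1 ler_pM2l.
pose c := x - N.+1%:R^-1.
have ec : e%:R < c * N.+1%:R.
  have te : Num.truncn (N.+1%:R * x) = (e + 2)%N by rewrite subnK // ltnW // -subn_gt0.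
  by move: t1; rewrite te natrD mulrBl mulVf ?gt_eqF // mulrC; lra.
apply: le_trans (card_cells_ge U_indep U_unif (N := N) (A := [set b | [forall l in S,
  (c <= spacing (grid R b) l)%R]]%SET) measurable_E _) _.
  move=> a w aw Ew; rewrite inE; apply/forall_inP => l lS.
  have := Ew l lS; have := cell_spacing l aw; rewrite ler_norml => /andP[_ us] xu.
  by rewrite lerBlDr (le_trans (ltW xu)) // -lerBlDl.
rewrite ler_pdivrMr ?exprn_gt0 // -exprMn.
apply: le_trans (_ : ((N.+1 - e * #|S|) ^ n)%:R <= _).
  by rewrite ler_nat card_wide_grids_le.
rewrite natrX lerXn2r ?nnegrE ?ler0n ?mulr_ge0 ?le_max ?lexx //.
rewrite maxr_pMl ?(ltW N0) // mul0r le_max [X in _ || (_ <= X)]mulrC.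
have [le|gt] := leqP (e * #|S|) N.+1.
  by rewrite natrB // natrM ySe orbT.
by rewrite (eqP (ltnW gt : (N.+1 - e * #|S| == 0)%N)) lexx.
Qed.

(** Only the number of spacings matters, not their positions: this is the
exchangeability of the spacings, obtained here as a by-product of the count. *)
Lemma probability_spacings_gt :
  P [set w | forall l, l \in S -> x < spacing (fun i => U i w) l] =
  (Num.max 0 (1 - #|S|%:R * x) ^+ n)%:E.
Proof.
rewrite -[LHS]fineK ?fin_num_measure //; congr (_%:E).
apply: (@squeeze_harmonic_pos_part _ _ _ (3 * n.+1 + n)%:R) => N.
by rewrite survival_ge survival_le.
Qed.

End spacing_survival.

(** * Counting how many events occur *)

(** Inversion of Pascal matrices: the coefficient of [X ^ p] in [(1 - (1 + X)) ^
N]. *)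
Lemma bin_orthogonality (R : comPzRingType) (M N p : nat) : (N < M)%N ->
  \sum_(j < M) (-1) ^+ j * ('C(j, p) * 'C(N, j))%:R = (-1) ^+ N *+ (N == p) :> R.
Proof.
elim: N M p => [|N IH] [//|M] p NM.
  rewrite big_ord_recl big1 => [|j _]; last by rewrite bin0n muln0 mulr0.
  by rewrite /= expr0 mul1r bin0n bin0 muln1 addr0 eq_sym.
have -> : \sum_(j < M.+1) (-1) ^+ j * ('C(j, p) * 'C(N.+1, j))%:R =
    \sum_(j < M.+1) (-1) ^+ j * ('C(j, p) * 'C(N, j))%:R
    - \sum_(j < M) (-1) ^+ j * ('C(j.+1, p) * 'C(N, j))%:R :> R.
  rewrite !big_ord_recl /= !bin0 -addrA -sumrB; congr (_ + _).
  apply: eq_bigr => j _; rewrite /= /bump /= add1n binS mulnDr natrD exprS; ring.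
rewrite IH ?(ltnW NM) //; case: p => [|p].
  have -> : \sum_(j < M) (-1) ^+ j * ('C(j.+1, 0) * 'C(N, j))%:R = (-1) ^+ N *+ (N == 0%N) :> R.
    by rewrite -(IH M) //; apply: eq_bigr => j _; rewrite !bin0.
  by rewrite subrr.
have -> : \sum_(j < M) (-1) ^+ j * ('C(j.+1, p.+1) * 'C(N, j))%:R =
    (-1) ^+ N *+ (N == p.+1) + (-1) ^+ N *+ (N == p) :> R.
  rewrite -!(IH M) // -big_split; apply: eq_bigr => j _.
  by rewrite binS mulnDl natrD mulrDr.
by rewrite opprD addrA subrr add0r eqSS exprS mulN1r mulNrn.
Qed.

(** By Pascal's rule, raising [N] by one adds an instance of the orthogonality
relation, which is nonzero exactly at the threshold [N = p]. *)
Lemma sum_bin_ltn (R : comPzRingType) (M N p : nat) : (N <= M)%N ->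
  \sum_(j < M) (-1) ^+ (j + p) * ('C(j, p) * 'C(N, j.+1))%:R = (p < N)%:R :> R.
Proof.
elim: N => [_|N IH NM]; first by apply: big1 => j _; rewrite bin0n muln0 mulr0.
have -> : \sum_(j < M) (-1) ^+ (j + p) * ('C(j, p) * 'C(N.+1, j.+1))%:R =
    \sum_(j < M) (-1) ^+ (j + p) * ('C(j, p) * 'C(N, j.+1))%:R +
    (-1) ^+ p * \sum_(j < M) (-1) ^+ j * ('C(j, p) * 'C(N, j))%:R :> R.
  rewrite mulr_sumr -big_split; apply: eq_bigr => j _.
  by rewrite binS mulnDr natrD mulrDr exprD /=; ring.
rewrite IH ?(ltnW NM) // bin_orthogonality // ltnS [in RHS]leq_eqVlt.
case: (eqVneq N p) => [->|Np]; last by rewrite mulr0n mulr0 addr0.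
by rewrite ltnn mulr1n -expr2 sqrr_sign add0r.
Qed.

(** Jordan's formula for a weight [q] on subsets: after exchanging the sums, [q
B] is multiplied on the right by a signed count of the subsets of [B], which
sum_bin_ltn evaluates to 1 or 0. *)
Lemma sum_large_sets (R : comPzRingType) (I : finType) (q : {set I} -> R) (p : nat) :
  \sum_(B : {set I} | (p < #|B|)%N) q B =
  \sum_(j < #|I|) (-1) ^+ (j + p) * 'C(j, p)%:R *
    \sum_(S : {set I} | #|S| == j.+1) \sum_(B : {set I} | S \subset B) q B.
Proof.
have subsets j (B : {set I}) : \sum_(S : {set I} | (#|S| == j) && (S \subset B)) 1 = 'C(#|B|, j)%:R :> R.
  rewrite sumr_const -cards_draws; congr (_%:R); apply: eq_card => S.
  by rewrite !inE andbC.
under [RHS]eq_bigr => j _.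
  rewrite (exchange_big_dep xpredT) //=.
  rewrite (eq_bigr (fun B : {set I} => 'C(#|B|, j.+1)%:R * q B)) => [|B _]; last first.
    by rewrite -subsets mulr_suml; apply: eq_bigr => S _; rewrite mul1r.
  rewrite mulr_sumr; over.
rewrite exchange_big /= big_mkcond; apply: eq_bigr => B _.
have := @sum_bin_ltn R #|I| #|B| p (max_card _) => e.
under eq_bigr => j _ do rewrite mulrA -(mulrA ((-1) ^+ _)) -natrM.
by rewrite -mulr_suml e; case: (p < #|B|)%N; rewrite ?mul1r ?mul0r.
Qed.

Section events.
Context (R : realType) (d : measure_display) (T : measurableType d) (P : probability T R).
Context (I : finType) (p : I -> T -> bool) (mp : forall i, measurable [set w | p i w]).

(** The sample space splits into the finitely many events that prescribe exactly
which [p i] hold. *)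
Lemma probability_finset_event (Q : {set I} -> bool) :
  P [set w | Q [set i | p i w]%SET] =
  (\sum_(B : {set I} | Q B) fine (P [set w | [set i | p i w]%SET == B]))%:E.
Proof.
have mB B : measurable [set w | [set i | p i w]%SET == B].
  exact: (measurable_finset_event (fun A => A == B) mp).
rewrite -sumEFin; under eq_bigr do rewrite fineK ?fin_num_measure //.
rewrite -big_filter -(probability_seq_bigcup P) //.
- congr (P _); apply/seteqP; split => [w Qw|w [B /= +  /eqP BE]].
    by exists [set i | p i w]%SET => /=; rewrite ?mem_filter ?Qw ?mem_index_enum.
  by rewrite mem_filter BE => /andP[].
- by rewrite filter_uniq ?index_enum_uniq.
- by move=> A B w /eqP <- /eqP.
Qed.
End events.

Section counting_events.
Context (R : realType) (d : measure_display) (T : measurableType d) (P : probability T R).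
Context (I : finType) (p : I -> T -> bool) (mp : forall i, measurable [set w | p i w]).

(** Jordan's form of inclusion-exclusion, applied to the distribution of the set
of indices whose event occurs. *)
Lemma probability_card_gt (q : nat) :
  P [set w | (q < #|[set i | p i w]%SET|)%N] =
  (\sum_(j < #|I|) (-1) ^+ (j + q) * 'C(j, q)%:R *
    \sum_(S : {set I} | #|S| == j.+1)
      fine (P [set w | forall i, i \in S -> p i w]))%:E.
Proof.
rewrite (probability_finset_event P mp (fun B : {set I} => q < #|B|)%N).
congr (_%:E); rewrite sum_large_sets; apply: eq_bigr => j _; congr (_ * _).
apply: eq_bigr => S _; apply: EFin_inj; rewrite fineK; last first.
  apply: fin_num_measure.
  have -> : [set w | forall i, i \in S -> p i w] = [set w | S \subset [set i | p i w]%SET].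
    apply/seteqP; split => w /= => [Sw|/fintype.subsetP Sw i /Sw]; last by rewrite inE.
    by apply/fintype.subsetP => i /Sw; rewrite inE.
  exact: (measurable_finset_event (fun B => S \subset B) mp).
rewrite -(probability_finset_event P mp (fun B => S \subset B)); congr (P _).
apply/seteqP; split => w /= => [/fintype.subsetP Sw i /Sw|Sw]; first by rewrite inE.
by apply/fintype.subsetP => i /Sw; rewrite inE.
Qed.

End counting_events.

(** * The distribution of the ordered spacings *)

(** With [k - 1 = r + s] and [n = r + s + p], both sides are [(n + 1)!] divided
by [r! s! p!]; this matches the coefficients of Jordan's formula with those of
the theorem. *)
Lemma bin_reindex (r s p : nat) :
  ((s + p).+1 * ('C(s + p, p) * 'C((r + s + p).+1, (s + p).+1)) =
   (r + s + p).+1 * 'C(r + s + p, r + s) * 'C(r + s, r))%N.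
Proof.
apply/eqP; rewrite -(eqn_pmul2r (fact_gt0 p)) -(eqn_pmul2r (fact_gt0 s)).
rewrite -(eqn_pmul2r (fact_gt0 r)); apply/eqP.
have f1 := @bin_fact (s + p) p (leq_addl _ _); rewrite addnK in f1.
have f2 : ('C((r + s + p).+1, (s + p).+1) * ((s + p).+1`! * r`!) = (r + s + p).+1`!)%N.
  by rewrite -[in RHS](@bin_fact _ (s + p).+1) ?ltnS -?addnA ?leq_addl // subSS addnK.
have f3 := @bin_fact (r + s + p) (r + s) (leq_addr _ _); rewrite addKn in f3.
have f4 := @bin_fact (r + s) r (leq_addr _ _); rewrite addKn in f4.
rewrite !factS in f2.
transitivity ('C((r + s + p).+1, (s + p).+1) * ((s + p).+1 * ('C(s + p, p) * (p`! * s`!)) * r`!))%N.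
  by ring.
rewrite f1 f2 -f3 -f4; ring.
Qed.

Theorem theorem1p1 (R : realType) (d : measure_display) (T : measurableType d)
    (P : probability T R) (n : nat) (U : 'I_n -> {RV P >-> R})
    (n_ge1 : (1 <= n)%N)
    (U_indep : mutually_independent U)
    (U_unif : forall i, uniform01 (U i))
    (k : nat) (k_range : (1 <= k <= n + 1)%N)
    (x : R) (x_range : 0 <= x <= 1) :
  P [set w | x < ordered_spacing (fun i => U i w) k] =
  ((-1) ^+ (k + 1) * (n + 1)%:R * 'C(n, k - 1)%:R *
   \sum_(0 <= r < k)
     (-1) ^+ r / (n%:R - r%:R + 1) * 'C(k - 1, r)%:R *
     Num.max 0 (1 - (n%:R - r%:R + 1) * x) ^+ n)%:E.
Proof.
case: k k_range => [|k] // k_range; rewrite addn1 ltnS in k_range.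
have x0 : 0 <= x by case/andP: x_range.
have km : (0 < k.+1 <= n.+1)%N by [].
have -> : [set w | x < ordered_spacing (fun i => U i w) k.+1] =
    [set w | (n - k < #|[set l | (x < spacing (fun i => U i w) l)%R]%SET|)%N].
  by apply/seteqP; split => w /=; rewrite /ordered_spacing lt_order_statE // subSS subSn.
rewrite (probability_card_gt P (measurable_lt_spacing U x)).
congr (_%:E); rewrite card_ord.
have draws j : #|[pred S : {set 'I_n.+1} | #|S| == j]| = 'C(n.+1, j).
  transitivity 'C(#|'I_n.+1|, j); last by rewrite card_ord.
  by rewrite -card_draws; apply: eq_card => S; rewrite !inE.
under eq_bigr => j _.
  under eq_bigr => S /eqP Sj do rewrite (probability_spacings_gt U_indep U_unif n_ge1 S x0) Sj /=.
  rewrite sumr_const draws; over.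
(* Summing over [r = n - j], where [j + 1] is the number of spacings involved; the
   terms with [r >= k] vanish. *)
rewrite (reindex_inj rev_ord_inj) /= big_mkord.
rewrite (big_ord_widen n.+1 (fun r => (-1) ^+ r / (n%:R - r%:R + 1) * 'C(k.+1 - 1, r)%:R *
     Num.max 0 (1 - (n%:R - r%:R + 1) * x) ^+ n)) //.
rewrite [in RHS]big_mkcond mulr_sumr; apply: eq_bigr => -[r rn] _ /=.
rewrite subSS subn1 /=; have [rk|kr] := ltnP r k.+1; last first.
  by rewrite bin_small ?mulr0 ?mul0r //; lia.
rewrite -natrB // natr1.
move: (Num.max _ _ ^+ n) => v.
have [s ks] : exists s, k = (r + s)%N by exists (k - r)%N; rewrite subnKC.
have [p np] : exists p, n = (r + s + p)%N by exists (n - k)%N; rewrite -ks subnKC // -ltnS.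
rewrite -mulr_natr ks np -addnA addKn addnA addKn.
have := congr1 (fun m => m%:R : R) (bin_reindex r s p); rewrite /= !natrM => bin.
have -> : (-1) ^+ (s + p + p) = (-1) ^+ ((r + s).+1 + 1) * (-1) ^+ r :> R.
  by rewrite addnS !exprS !exprD; ring: (sqrr_sign R p) (sqrr_sign R r).
have D0 : (s + p).+1%:R != 0 :> R by rewrite pnatr_eq0.
rewrite [in X in _ = _ * X * _ * _]addn1.
transitivity ((-1) ^+ ((r + s).+1 + 1) * (-1) ^+ r * v / (s + p).+1%:R *
    ((s + p).+1%:R * ('C(s + p, p)%:R * 'C((r + s + p).+1, (s + p).+1)%:R))).
  by rewrite ?addnA; field.
by rewrite bin ?addnA; field.
Qed.
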